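(* Consider the panel change point model \[ Y_{i,t}=\mu_i+\delta_i\,\mathbb{I}\{t>\tau\}+\sigma\varepsilon_{i,t},\qquad 1\le i\le N,\ 1\le t\le T, \] with $T$ fixed (not depending on $N$), where the common change point $\tau$ is fixed with $1\le\tau\le T-3$, and the change sizes $\delta_i=\delta_i^{(N)}$ (which may depend on $N$) satisfy \[ \lim_{N\to\infty}\frac{1}{\sqrt N}\Big|\sum_{i=1}^N\delta_i\Big|=\infty . \] Suppose the error assumption stated in the context holds. Then, with $\mathcal{C}_N(T)$ and $\mathcal{R}_N(T)$ as defined in the context, \[ \mathcal{C}_N(T)\xrightarrow{\ \mathsf P\ }\infty\quad\text{and}\quad \mathcal{R}_N(T)\xrightarrow{\ \mathsf P\ }\infty\qquad (N\to\infty). \]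
   Context: In the model, $\sigma>0$ is an unknown scale parameter, $\mu_i\in\mathbb{R}$ are panel-specific means and $\delta_i\in\mathbb{R}$ panel-specific change sizes. Error assumption: the random vectors $[\varepsilon_{i,1},\ldots,\varepsilon_{i,T}]^\top$, $i=1,\ldots,N$, are i.i.d. across $i$, with $\mathsf E\varepsilon_{i,t}=0$, $\mathsf{Var}\,\varepsilon_{i,t}=1$, and autocorrelation $\rho_t=\mathsf{Cov}(\varepsilon_{i,s},\varepsilon_{i,s+t})$ not depending on $s\in\{1,\ldots,T-t\}$. Statistics: with $\bar Y_{i,t}=\frac1t\sum_{s=1}^tY_{i,s}$ and $\tilde Y_{i,t}=\frac{1}{T-t}\sum_{s=t+1}^TY_{i,s}$, \[ \mathcal{C}_N(T)=\frac{1}{\sqrt{N}}\max_{t=1,\ldots,T-1}\Big|\sum_{i=1}^N\sum_{s=1}^t\big(Y_{i,s}-\bar Y_{i,T}\big)\Big|, \] \[ \mathcal{R}_N(T)=\max_{t=2,\ldots,T-2}\frac{\max_{s=1,\ldots,t}\Big|\sum_{i=1}^N\sum_{r=1}^s\big(Y_{i,r}-\bar Y_{i,t}\big)\Big|}{\max_{s=t,\ldots,T-1}\Big|\sum_{i=1}^N\sum_{r=s+1}^T\big(Y_{i,r}-\tilde Y_{i,t}\big)\Big|}. \] *)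

(* Defs.v *)
From HB Require Import structures.
From mathcomp Require Import all_boot all_order all_algebra.
From mathcomp Require Import all_classical all_reals all_analysis.
Set Implicit Arguments.
Unset Strict Implicit.
Unset Printing Implicit Defensive.
Import Order.TTheory GRing.Theory Num.Theory.
Import numFieldNormedType.Exports.
Local Open Scope classical_set_scope.
Local Open Scope ring_scope.

Section panel.
Variables (R : realType).

(* Indices: panels i = 1..N, times t = 1..T (index 0 is unused). *)

Definition Yobs (Omega : Type) (mu : nat -> R) (delta : nat -> nat -> R)
  (sigma : R) (tau : nat) (eps : nat -> nat -> Omega -> R)
  (N i t : nat) (w : Omega) : R :=
  mu i + (if (tau < t)%N then delta N i else 0) + sigma * eps i t w.

Definition Ybar (Y : nat -> nat -> R) (i t : nat) : R :=
  t%:R^-1 * \sum_(1 <= s < t.+1) Y i s.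

Definition Ytilde (T : nat) (Y : nat -> nat -> R) (i t : nat) : R :=
  (T - t)%:R^-1 * \sum_(t.+1 <= s < T.+1) Y i s.

Definition CN (N T : nat) (Y : nat -> nat -> R) : R :=
  (Num.sqrt N%:R)^-1 *
  \big[Num.max/0]_(1 <= t < T)
    `| \sum_(1 <= i < N.+1) \sum_(1 <= s < t.+1) (Y i s - Ybar Y i T) |.

(* ratio a/b of nonnegative reals with values in the extended reals,
   with the convention a/0 = +oo for a > 0 (and 0/0 = 0). *)
Definition eratio (a b : R) : \bar R :=
  if b == 0 then (if a == 0 then 0%E else +oo%E) else (a / b)%:E.

Definition RN_num (N : nat) (Y : nat -> nat -> R) (t : nat) : R :=
  \big[Num.max/0]_(1 <= s < t.+1)
    `| \sum_(1 <= i < N.+1) \sum_(1 <= r < s.+1) (Y i r - Ybar Y i t) |.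

Definition RN_den (N T : nat) (Y : nat -> nat -> R) (t : nat) : R :=
  \big[Num.max/0]_(t <= s < T)
    `| \sum_(1 <= i < N.+1) \sum_(s.+1 <= r < T.+1) (Y i r - Ytilde T Y i t) |.

Definition RNstat (N T : nat) (Y : nat -> nat -> R) : \bar R :=
  \big[Order.max/0%E]_(2 <= t < T.-1) eratio (RN_num N Y t) (RN_den N T Y t).

End panel.

Section errors.
Variables (d : measure_display) (Omega : measurableType d) (R : realType)
  (P : probability Omega R).

(* The random vectors [eps_{i,1},...,eps_{i,T}], i >= 1, are mutually
   independent: product rule on measurable rectangles
   (a pi-system generating the product sigma-algebra of R^T). *)
Definition rows_independent (T : nat) (eps : nat -> nat -> Omega -> R) : Prop :=
  forall (I : seq nat) (B : nat -> nat -> set R),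
    uniq I -> all (fun i => (0 < i)%N) I ->
    (forall i t, measurable (B i t)) ->
    fine (P [set w | forall i, i \in I ->
                forall t, (1 <= t <= T)%N -> B i t (eps i t w)])
    = \prod_(i <- I) fine (P [set w | forall t, (1 <= t <= T)%N -> B i t (eps i t w)]).

Definition rows_identically_distributed (T : nat) (eps : nat -> nat -> Omega -> R) : Prop :=
  forall (i j : nat) (B : nat -> set R),
    (0 < i)%N -> (0 < j)%N -> (forall t, measurable (B t)) ->
    P [set w | forall t, (1 <= t <= T)%N -> B t (eps i t w)]
    = P [set w | forall t, (1 <= t <= T)%N -> B t (eps j t w)].

End errors.

(* Main.v *)
(* Summed over the panels, the observations at time t are m + D 1{t > tau} + sigma S_t
   with D the total change size and S_t the total noise. Both statistics only
   see centered partial sums, so m cancels. At t = tau the change contributes a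
   fixed positive multiple of |D| to C_N; for R_N, the split t = tau + 1 (allowed
   since tau <= T - 3) puts the change in the numerator only. Hence on
   {statistic <= M} one has |D| <= const * (sqrt N + sum_t |S_t|). Independence of
   the panels gives E S_t^2 = N, so sum_t |S_t| = O_P(sqrt N), while
   |D| / sqrt N tends to infinity. *)
Require Import Defs.
From HB Require Import structures.
From mathcomp Require Import all_boot all_order all_algebra.
From mathcomp Require Import all_classical all_reals all_analysis.
From mathcomp Require Import measurable_realfun.
From mathcomp Require Import ring lra zify.
Import Order.TTheory GRing.Theory Num.Theory.
Import numFieldNormedType.Exports.
Local Open Scope classical_set_scope.
Local Open Scope ring_scope.

(** * Deterministic identities and bounds for finite sums *)

(** Centering is linear, so summing over the panels first reduces everything to a single series of
    panel totals. Leaving [a], [J] and [K] free covers the centering by [Ybar] as well as by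
    [Ytilde]. *)
Lemma sum_centered_exchange (R : realType) (N : nat) (J K : seq nat) (a : R)
    (Y : nat -> nat -> R) :
  \sum_(1 <= i < N.+1) \sum_(s <- J) (Y i s - a * \sum_(r <- K) Y i r) =
  \sum_(s <- J) (\sum_(1 <= i < N.+1) Y i s
                 - a * \sum_(r <- K) \sum_(1 <= i < N.+1) Y i r).
Proof.
rewrite exchange_big/=; apply: eq_bigr => s _.
by rewrite sumrB -mulr_sumr exchange_big.
Qed.

Lemma norm_sum_nat_le (R : realType) (S : nat -> R) (a b T : nat) :
  (0 < a)%N -> (b <= T.+1)%N ->
  `|\sum_(a <= s < b) S s| <= \sum_(1 <= s < T.+1) `|S s|.
Proof.
move=> a0 bT; apply: le_trans (ler_norm_sum _ _ _) _.
have [ab|ba] := leqP a b; last by rewrite big_geq ?sumr_ge0 // ltnW.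
rewrite [leRHS](@big_cat_nat _ _ _ a)//= ?(leq_trans ab)//.
rewrite [X in _ <= _ + X](@big_cat_nat _ _ _ b)//=.
by rewrite addrCA lerDl addr_ge0// sumr_ge0.
Qed.

(** The boundary case [u = tau] is included on purpose: it says that the sum up to the change point
    contains no jump. *)
Lemma sum_step (R : realType) (tau u : nat) (D : R) : (tau <= u)%N ->
  \sum_(1 <= r < u.+1) (if (tau < r)%N then D else 0) = (u - tau)%:R * D.
Proof.
move=> tu; rewrite (@big_cat_nat _ _ _ tau.+1)//=.
rewrite big1_seq ?add0r; last first.
  by move=> r /=; rewrite mem_index_iota ltnS => /andP[_]; rewrite leqNgt => /negbTE ->.
rewrite (@eq_big_nat _ _ _ _ _ _ (fun=> D)); last by move=> r /andP[->].
by rewrite sumr_const_nat subSS mulr_natl.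
Qed.

(** * The aggregated series: signal and noise in centered partial sums *)

Section aggregate.
Variables (R : realType) (T tau : nat) (m D sigma : R) (S : nat -> R).
Hypotheses (tau_gt0 : (0 < tau)%N) (sigma_gt0 : 0 < sigma).

Let Z s := m + (if (tau < s)%N then D else 0) + sigma * S s.
Let U := \sum_(1 <= s < T.+1) `|S s|.

(** The first [tau] terms contain no jump, while the mean over [1..u] contains the fraction
    [(u - tau) / u] of [D]; this mismatch, repeated [tau] times, is the signal. The noise consists
    of two partial sums, the second with weight [tau / u <= 1], each bounded by [U]. *)
Lemma before_change_ge (u : nat) : (tau < u <= T)%N ->
  tau%:R * (u - tau)%:R / u%:R * `|D| - 2 * sigma * U <=
  `|\sum_(1 <= s < tau.+1) (Z s - u%:R^-1 * \sum_(1 <= r < u.+1) Z r)|.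
Proof.
move=> /andP[tu uT].
have u0 : u%:R != 0 :> R by rewrite pnatr_eq0; lia.
set S1 := \sum_(1 <= s < tau.+1) S s; set S2 := \sum_(1 <= s < u.+1) S s.
have S1U : `|S1| <= U by apply: norm_sum_nat_le => //; lia.
have S2U : `|S2| <= U by apply: norm_sum_nat_le => //; lia.
have -> : \sum_(1 <= s < tau.+1) (Z s - u%:R^-1 * \sum_(1 <= r < u.+1) Z r) =
    - (tau%:R * (u - tau)%:R / u%:R * D) + sigma * (S1 - tau%:R / u%:R * S2).
  rewrite sumrB sumr_const_nat !big_split/= !sumr_const_nat -!mulr_sumr.
  rewrite !sum_step// ?(ltnW tu)// subnn !subn1/= -/S1 -/S2.
  have mulrnE (x : R) n : x *+ n = x * n%:R by rewrite mulr_natr.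
  rewrite (mulrnE m) (mulrnE m u) (mulrnE (_ * _)).
  rewrite mul0r addr0.
  by field.
set c := _ / u%:R.
have c0 : 0 <= c by rewrite /c !mulr_ge0// invr_ge0.
have q1 : 0 <= (tau%:R / u%:R : R) <= 1.
  by rewrite divr_ge0//= ler_pdivrMr ?mul1r ?ler_nat ?ltr0n; lia.
have nq : `|tau%:R / u%:R * S2| <= U.
  rewrite normrM ger0_norm; last by case/andP: q1.
  by case/andP: q1 => q0 q1; apply: le_trans S2U; rewrite ler_piMl.
have n2 : `|sigma * (S1 - tau%:R / u%:R * S2)| <= 2 * sigma * U.
  rewrite normrM gtr0_norm// (_ : 2 * sigma * U = sigma * (U + U)); last by ring.
  rewrite ler_pM2l//.
  by apply: le_trans (ler_normB _ _) _; exact: lerD.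
have -> : c * `|D| = `|c * D| by rewrite normrM (ger0_norm c0).
rewrite lerBlDr.
move: n2; set E := sigma * _ => n2.
(* Reverse triangle inequality: the signal is the noise [E] minus the whole centered sum. *)
have {1}-> : c * D = E - (- (c * D) + E) by ring.
by apply: le_trans (ler_normB _ _) _; rewrite [leLHS]addrC lerD2l.
Qed.

(** All terms involved lie after the change and share the level [m + D], which the centering
    removes. Only noise remains, and [u <= s] keeps the weight [(T - s) / (T - u)] at most 1. *)
Lemma after_change_le (u s : nat) : (tau <= u <= s)%N -> (s < T)%N ->
  `|\sum_(s.+1 <= r < T.+1) (Z r - (T - u)%:R^-1 * \sum_(u.+1 <= q < T.+1) Z q)|
  <= 2 * sigma * U.
Proof.
move=> /andP[tu us] sT.
have v0 : (T - u)%:R != 0 :> R by rewrite pnatr_eq0; lia.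
set S1 := \sum_(s.+1 <= r < T.+1) S r; set S2 := \sum_(u.+1 <= r < T.+1) S r.
have S1U : `|S1| <= U by apply: norm_sum_nat_le => //; lia.
have S2U : `|S2| <= U by apply: norm_sum_nat_le => //; lia.
have ZE a : (tau <= a)%N ->
    \sum_(a.+1 <= r < T.+1) Z r =
    (m + D) * (T - a)%:R + sigma * \sum_(a.+1 <= r < T.+1) S r.
  move=> ta; rewrite (@eq_big_nat _ _ _ _ _ _ (fun r => m + D + sigma * S r)).
    by rewrite big_split/= sumr_const_nat -mulr_sumr subSS mulr_natr.
  by move=> r /andP[ar _]; rewrite /Z ifT//; lia.
have -> : \sum_(s.+1 <= r < T.+1)
      (Z r - (T - u)%:R^-1 * \sum_(u.+1 <= q < T.+1) Z q) =
    sigma * (S1 - (T - s)%:R / (T - u)%:R * S2).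
  rewrite sumrB sumr_const_nat !ZE ?(leq_trans tu)// -/S1 -/S2 subSS.
  have mulrnE (x : R) n : x *+ n = x * n%:R by rewrite mulr_natr.
  by rewrite (mulrnE (_ * _)); field.
have /andP[q0 q1] : 0 <= ((T - s)%:R / (T - u)%:R : R) <= 1.
  by rewrite divr_ge0//= ler_pdivrMr ?mul1r ?ler_nat ?ltr0n; lia.
rewrite normrM gtr0_norm// (_ : 2 * sigma * U = sigma * (U + U)); last by ring.
rewrite ler_pM2l//; apply: le_trans (ler_normB _ _) _; apply: lerD => //.
by rewrite normrM ger0_norm//; apply: le_trans S2U; rewrite ler_piMl.
Qed.

End aggregate.

(** * Expectation of a product of independent variables *)

Section independence.
Context d (Omega : measurableType d) (R : realType) (P : probability Omega R).

(** The product rule on rectangles identifies the law of the pair with the product of the marginal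
    laws; Fubini then factors the integral of [x * y]. Square integrability makes the product
    integrable. *)
Lemma expectation_mul_independent (X Y : Omega -> R) :
  X \in Lfun P 2%:E -> Y \in Lfun P 2%:E ->
  (forall A B : set R, measurable A -> measurable B ->
    P (X @^-1` A `&` Y @^-1` B) = (P (X @^-1` A) * P (Y @^-1` B))%E) ->
  ('E_P[X \* Y] = 'E_P[X] * 'E_P[Y])%E.
Proof.
move=> X2 Y2 indXY.
have Pfin : P setT \is a fin_num := fin_num_measure P _ measurableT.
have /Lfun1_integrable iX := Lfun_subset12 Pfin X2.
have /Lfun1_integrable iY := Lfun_subset12 Pfin Y2.
have /Lfun1_integrable iXY := Lfun2_mul_Lfun1 X2 Y2.
have mX : measurable_fun setT X by apply/measurable_EFinP/measurable_int/iX.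
have mY : measurable_fun setT Y by apply/measurable_EFinP/measurable_int/iY.
pose X' : {mfun Omega >-> R} := HB.pack X (isMeasurableFun.Build _ _ _ _ _ mX).
pose Y' : {mfun Omega >-> R} := HB.pack Y (isMeasurableFun.Build _ _ _ _ _ mY).
pose XY w := (X w, Y w).
have mXY : measurable_fun setT XY by exact: measurable_fun_pair.
pose XY' : {mfun Omega >-> (R * R)%type} :=
  HB.pack XY (isMeasurableFun.Build _ _ _ _ _ mXY).
pose f (z : R * R) := (z.1 * z.2)%:E.
have mf : measurable_fun setT f by apply/measurable_EFinP; apply: measurable_funM.
have PXY A : measurable A ->
    (distribution P X' \x distribution P Y')%E A = distribution P XY' A.
  by apply: product_measure_unique => A0 B mA mB; rewrite /= /pushforward/= -indXY.
(* Fubini needs integrability under the product law; it is transported from [P] through the joint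
   law. *)
have intf : (distribution P X' \x distribution P Y')%E.-integrable setT f.
  have := @integrable_pushforward _ _ _ _ _ _ mXY P setT f mf iXY measurableT.
  move=> /integrableP[_ h]; apply/integrableP; split => //.
  apply: le_lt_trans h; rewrite (eq_measure_integral (distribution P XY'))//.
  by move=> A mA _; exact: PXY.
rewrite !unlock.
transitivity (\int[(distribution P X' \x distribution P Y')%E]_z f z)%E.
  rewrite (eq_measure_integral (distribution P XY')); last first.
    by move=> A mA _; exact: PXY.
  by rewrite integral_distribution.
rewrite -integral12_prod_meas1//.
have iX' : (distribution P X').-integrable setT EFin.
  by apply: integrable_pushforward => //; exact: mX.
have iY' : (distribution P Y').-integrable setT EFin.
  by apply: integrable_pushforward => //; exact: mY.
have EX : (\int[distribution P X']_x x%:E = \int[P]_w (X w)%:E)%E.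
  by rewrite integral_distribution.
have EY : (\int[distribution P Y']_x x%:E = \int[P]_w (Y w)%:E)%E.
  by rewrite integral_distribution.
have fY := integrable_fin_num measurableT iY.
under eq_integral => x _.
  rewrite /fubini_F /f/=; under eq_integral => y _ do rewrite EFinM.
  rewrite integralZl// EY -(fineK fY).
  over.
by rewrite /= integralZr// EX fineK.
Qed.

End independence.

(** * Moments of the noise and a Markov-type convergence criterion *)

Section moments.
Context d (Omega : measurableType d) (R : realType) (P : probability Omega R).

Lemma rows_independent_pair (T : nat) (eps : nat -> nat -> Omega -> R)
    (i j t : nat) (A B : set R) :
  rows_independent P T eps -> (0 < i)%N -> (0 < j)%N -> i != j ->
  (1 <= t <= T)%N ->
  measurable_fun setT (eps i t) -> measurable_fun setT (eps j t) ->
  measurable A -> measurable B ->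
  P (eps i t @^-1` A `&` eps j t @^-1` B) =
  (P (eps i t @^-1` A) * P (eps j t @^-1` B))%E.
Proof.
move=> indep i0 j0 ij tT mi mj mA mB.
(* Rectangles that are trivial at every time except [t] extract the independence of the two
   coordinates from that of the rows. *)
pose C k s : set R :=
  if s == t then if k == i then A else B else setT.
have mC k s : measurable (C k s) by rewrite /C; case: ifP => // _; case: ifP.
have := indep [:: i; j] C.
rewrite /= inE ij i0 j0 => /(_ isT isT mC).
have rowE k : [set w | forall s, (1 <= s <= T)%N -> C k s (eps k s w)] =
    eps k t @^-1` (if k == i then A else B).
  apply/seteqP; split => w /=.
    by move=> /(_ t tT); rewrite /C eqxx.
  by move=> h s sT; rewrite /C; case: eqP => // ->.
have -> : [set w | forall k, k \in [:: i; j] ->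
      forall s, (1 <= s <= T)%N -> C k s (eps k s w)] =
    eps i t @^-1` A `&` eps j t @^-1` B.
  have := rowE i; have := rowE j; rewrite eqxx eq_sym (negbTE ij) => <- <-.
  apply/seteqP; split => w /=.
    by move=> h; split; apply: h; rewrite !inE eqxx ?orbT.
  by move=> [hi hj] k; rewrite !inE => /orP[] /eqP ->.
rewrite big_cons big_seq1 !rowE eqxx eq_sym (negbTE ij) => h.
have mXA k (E : set R) : measurable_fun setT (eps k t) -> measurable E ->
    measurable (eps k t @^-1` E).
  by move=> mk mE; rewrite -[X in measurable X]setTI; exact: mk.
(* Row independence is stated for real numbers through [fine]; finiteness of the probabilities lifts
   the identity back to the extended reals. *)
rewrite -[LHS]fineK; last by rewrite fin_num_measure//; apply: measurableI; apply: mXA.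
by rewrite h EFinM !fineK// fin_num_measure//; apply: mXA.
Qed.

Lemma expectation_bigsum (I : eqType) (s : seq I) (F : I -> Omega -> R) :
  {in s, forall i, F i \in Lfun P 1} ->
  ('E_P[fun w => (\sum_(i <- s) F i w)%R] = \sum_(i <- s) 'E_P[F i])%E.
Proof.
move=> F1; rewrite -(big_map F predT (fun f => 'E_P[f]%E)) -expectation_sum.
  by congr expectation; rewrite big_map; apply/funext => w; rewrite fct_sumE.
by move=> _ /mapP[i si ->]; exact: F1.
Qed.

(** Pythagoras: after expanding the square, the off-diagonal terms vanish, and by [uniq s] each
    index meets itself exactly once. *)
Lemma expectation_sqr_sum_orthonormal (I : eqType) (s : seq I)
    (X : I -> Omega -> R) : uniq s ->
  {in s, forall i, X i \in Lfun P 2%:E} ->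
  {in s &, forall i j, ('E_P[X i \* X j] = (i == j)%:R%:E)%E} ->
  ('E_P[fun w => ((\sum_(i <- s) X i w) ^+ 2)%R] = (size s)%:R%:E)%E.
Proof.
move=> us X2 XX.
under eq_fun do rewrite expr2 big_distrlr/=.
rewrite (expectation_bigsum _ _ (fun i w => \sum_(j <- s) X i w * X j w)); last first.
  move=> i si; rewrite [X in X \in _](_ : _ = \sum_(j <- s) X i \* X j).
    by rewrite big_seq rpred_sum// => j sj; rewrite Lfun2_mul_Lfun1// X2.
  by apply/funext => w; rewrite fct_sumE.
rewrite big_seq; under eq_bigr => i si.
  rewrite (expectation_bigsum _ _ (fun j => X i \* X j)); last first.
    by move=> j sj; rewrite Lfun2_mul_Lfun1// X2.
  rewrite big_seq; under eq_bigr => j sj do rewrite XX//.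
  rewrite -big_seq (bigD1_seq i)//= eqxx big1 ?adde0; last first.
    by move=> j /negbTE; rewrite eq_sym => ->.
  over.
by rewrite -big_seq sumEFin big_const_seq count_predT iter_addr_0.
Qed.

Lemma markov_ge0 (X : Omega -> R) (k : R) :
  measurable_fun setT X -> (forall w, 0 <= X w) -> 0 < k ->
  (k%:E * P [set w | (k <= X w)%R] <= 'E_P[X])%E.
Proof.
move=> mX X0 k0.
pose X' : {mfun Omega >-> R} := HB.pack X (isMeasurableFun.Build _ _ _ _ _ mX).
have := @markov _ _ _ P X' id k k0 (@measurable_id _ _ _) (fun _ => id)
  (fun _ _ _ _ => id).
rewrite (_ : id \o _ \o X' = X); last by apply/funext => w /=; rewrite ger0_norm.
apply: le_trans; rewrite lee_pmul2l// ?lte_fin// le_eqVlt; apply/orP; left.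
apply/eqP; congr (P _); apply: eq_set => w.
by rewrite /= lee_fin ger0_norm.
Qed.

(* Termwise, y <= 1 + y^2: this lets Markov's inequality for the sum of squares
   replace a union bound over t. *)
Lemma sum_norm_le_sqr (T : nat) (S : nat -> R) (q : R) : 0 < q ->
  q^-1 * \sum_(1 <= t < T.+1) `|S t| <=
  T%:R + (q ^+ 2)^-1 * \sum_(1 <= t < T.+1) S t ^+ 2.
Proof.
move=> q0; rewrite !mulr_sumr.
have -> : T%:R = \sum_(1 <= t < T.+1) (1 : R) by rewrite sumr_const_nat subSS subn0.
rewrite -big_split/=; apply: ler_sum => t _.
rewrite -(real_normK (num_real (S t))) -exprVn -exprMn.
set y := _ * `|_|; nra.
Qed.

(** On [A N] the diverging deterministic [x N] is controlled by [Q N w / N], whose mean stays below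
    [C]. So [A N] eventually forces [Q N] above any fixed multiple of [N], which Markov's inequality
    makes improbable. *)
Lemma cvg_probability0 (A : nat -> set Omega) (Q : nat -> Omega -> R)
    (x : nat -> R) (a b C : R) :
  0 < b -> 0 <= C ->
  (forall N, measurable (A N)) ->
  (forall N, measurable_fun setT (Q N)) -> (forall N w, 0 <= Q N w) ->
  (forall N, ('E_P[Q N] <= (C * N%:R)%:E)%E) ->
  (forall N w, (0 < N)%N -> A N w -> x N <= a + b * (Q N w / N%:R)) ->
  x @ \oo --> +oo ->
  (fun N => P (A N)) @ \oo --> 0%E.
Proof.
move=> b0 C0 mA mQ Q0 EQ AQ /cvgryPge xoo.
have fA N : P (A N) \is a fin_num by rewrite fin_num_measure.
apply/fine_cvgP; split; first by apply: nearW.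
apply/cvgrPdist_le => e e0; near=> N.
have N0 : (0 < N)%N by near: N; exact: nbhs_infty_gt.
have NR0 : 0 < N%:R :> R by rewrite ltr0n.
(* Markov's inequality will give the bound [C / K], which is at most [e]; the added 1 keeps [K]
   positive when [C = 0]. *)
pose K := (C + 1) / e.
have K0 : 0 < K by rewrite divr_gt0// ltr_wpDl.
have xN : a + b * K <= x N by near: N; exact: xoo.
rewrite /= sub0r normrN ger0_norm ?fine_ge0//.
rewrite -lee_fin fineK//.
have mK : measurable [set w | K * N%:R <= Q N w].
  by rewrite -[X in measurable X]setTI; apply: measurable_fun_le => //; exact: mQ.
apply: (@le_trans _ _ (P [set w | K * N%:R <= Q N w])).
  apply: le_measure; rewrite ?inE// => w Aw /=.
  have := le_trans xN (AQ N w N0 Aw).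
  by rewrite lerD2l ler_pM2l// ler_pdivlMr.
have KN0 : 0 < K * N%:R by rewrite mulr_gt0.
have := le_trans (markov_ge0 _ _ (mQ N) (Q0 N) KN0) (EQ N).
rewrite -lee_pdivlMl// => /le_trans; apply.
rewrite -EFinM lee_fin mulrC ler_pdivrMr// mulrA /K mulrCA divff ?gt_eqF// mulr1.
by rewrite ler_pM2r// lerDl.
Unshelve. all: by end_near. Qed.

(** * Measurability of finite sums, maxima and ratios *)

Lemma measurable_sum_seq (I : eqType) (s : seq I) (F : I -> Omega -> R) :
  {in s, forall i, measurable_fun setT (F i)} ->
  measurable_fun setT (fun w => \sum_(i <- s) F i w).
Proof.
elim: s => [|i s IH] mF.
  by under eq_fun do rewrite big_nil; exact: measurable_cst.
under eq_fun do rewrite big_cons; apply: measurable_funD.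
  by apply: mF; rewrite mem_head.
by apply: IH => j js; apply: mF; rewrite inE js orbT.
Qed.

Lemma measurable_bigmaxr_seq (I : eqType) (s : seq I) (F : I -> Omega -> R) :
  {in s, forall i, measurable_fun setT (F i)} ->
  measurable_fun setT (fun w => \big[Num.max/0]_(i <- s) F i w).
Proof.
elim: s => [|i s IH] mF.
  by under eq_fun do rewrite big_nil; exact: measurable_cst.
under eq_fun do rewrite big_cons; apply: measurable_maxr.
  by apply: mF; rewrite mem_head.
by apply: IH => j js; apply: mF; rewrite inE js orbT.
Qed.

(** Turns an extended-real bound into a Boolean test on reals, for which measurability is directly
    available. A zero denominator allows a finite bound only through the convention [0/0 = 0]. *)
Lemma eratio_le (a b M : R) : 0 <= b ->
  (eratio a b <= M%:E)%E =
  if b == 0 then (a == 0) && (0 <= M) else a <= M * b.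
Proof.
rewrite /eratio le_eqVlt eq_sym => /orP[->|b0].
  by case: ifP => _; rewrite ?lee_fin// leye_eq.
by rewrite gt_eqF// lee_fin ler_pdivrMr.
Qed.

Lemma measurable_bigmax_eratio_le (s : seq nat) (F G : nat -> Omega -> R) (M : R) :
  {in s, forall i, measurable_fun setT (F i)} ->
  {in s, forall i, measurable_fun setT (G i)} ->
  (forall i w, 0 <= G i w) ->
  measurable [set w | (\big[Order.max/0%E]_(i <- s) eratio (F i w) (G i w) <= M%:E)%E].
Proof.
move=> + + G0; elim: s => [|i s IH] mF mG.
  rewrite (_ : [set w | _] = [set w | (0 <= M%:E)%E]); last first.
    by apply: eq_set => w; rewrite big_nil.
  (* The empty maximum is 0, so the event is everything or nothing according to the sign of [M]. *)
  have [M0|M0] := boolP (0 <= M%:E :> \bar R)%E.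
    by rewrite (_ : mkset _ = setT)//; apply/seteqP.
  by rewrite (_ : mkset _ = set0)//; apply/seteqP; split => // w /=; apply/negP.
rewrite (_ : [set w | _] =
    [set w | if G i w == 0 then (F i w == 0) && (0 <= M) else F i w <= M * G i w]
    `&` [set w | (\big[Order.max/0%E]_(i <- s) eratio (F i w) (G i w) <= M%:E)%E]);
  last first.
  apply/seteqP; split => w /=; rewrite big_cons ge_max eratio_le//; first by move/andP.
  by case=> -> ->.
have mFi : measurable_fun setT (F i) by apply: mF; rewrite mem_head.
have mGi : measurable_fun setT (G i) by apply: mG; rewrite mem_head.
apply: measurableI; last first.
  by apply: IH => j js; [apply: mF|apply: mG]; rewrite inE js orbT.
have mB : measurable_fun setT (fun w =>
    if G i w == 0 then (F i w == 0) && (0 <= M) else F i w <= M * G i w).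
  apply: measurable_fun_ifT.
  - by apply: measurable_fun_eqr => //; exact: measurable_cst.
  - apply: measurable_and; last exact: measurable_cst.
    by apply: measurable_fun_eqr => //; exact: measurable_cst.
  - apply: measurable_fun_ler => //.
    by apply: measurable_funM => //; exact: measurable_cst.
by have := mB measurableT [set true]; rewrite setTI; apply.
Qed.

End moments.

(** * Bounds on the two statistics by total change and total noise *)

Section statistics.
Context (R : realType) (Omega : Type).
Variables (T tau : nat) (sigma : R) (mu : nat -> R) (delta : nat -> nat -> R).
Variables (eps : nat -> nat -> Omega -> R) (N : nat) (w : Omega).
Hypotheses (tau_gt0 : (0 < tau)%N) (sigma_gt0 : 0 < sigma).

Let Y i t := Yobs mu delta sigma tau eps N i t w.
Let D := \sum_(1 <= i < N.+1) delta N i.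
Let U := \sum_(1 <= t < T.+1) `|\sum_(1 <= i < N.+1) eps i t w|.

Lemma Yobs_sum (s : nat) :
  \sum_(1 <= i < N.+1) Y i s =
  \sum_(1 <= i < N.+1) mu i + (if (tau < s)%N then D else 0)
  + sigma * \sum_(1 <= i < N.+1) eps i s w.
Proof.
rewrite mulr_sumr /D; case: ifPn => ts.
  by rewrite -!big_split/=; apply: eq_bigr => i _; rewrite /Y /Yobs ts.
rewrite addr0 -big_split/=; apply: eq_bigr => i _.
by rewrite /Y /Yobs (negbTE ts) addr0.
Qed.

Lemma Yobs_before_change_ge (u : nat) : (tau < u <= T)%N ->
  tau%:R * (u - tau)%:R / u%:R * `|D| - 2 * sigma * U <=
  `|\sum_(1 <= i < N.+1) \sum_(1 <= s < tau.+1) (Y i s - Ybar Y i u)|.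
Proof.
move=> tuT; rewrite sum_centered_exchange.
under eq_bigr do rewrite Yobs_sum (eq_bigr _ (fun r _ => Yobs_sum r)).
exact: before_change_ge.
Qed.

(** Only the term [t = tau] of the maximum is kept, with the overall mean, that is [u = T]. *)
Lemma CN_ge : (tau < T)%N ->
  (Num.sqrt N%:R)^-1 * (tau%:R * (T - tau)%:R / T%:R * `|D| - 2 * sigma * U)
  <= CN N T Y.
Proof.
move=> tT; rewrite /CN ler_wpM2l ?invr_ge0 ?sqrtr_ge0//.
apply: le_trans (Yobs_before_change_ge T _) _; first by rewrite tT leqnn.
by apply: (@bigmax_sup_seq _ _ _ _ _ tau) => //; rewrite mem_index_iota tau_gt0.
Qed.

(** Only the term [s = tau] is kept. Splitting at [u = tau + 1] leaves a single changed observation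
    in the window, whence the factor [tau / (tau + 1)]. *)
Lemma RN_num_ge : (tau < T)%N ->
  tau%:R / tau.+1%:R * `|D| - 2 * sigma * U <= RN_num N Y tau.+1.
Proof.
move=> tT; have := Yobs_before_change_ge tau.+1.
rewrite leqnn tT subSnn mulr1 => /(_ isT) /le_trans; apply.
by apply: (@bigmax_sup_seq _ _ _ _ _ tau) => //; rewrite mem_index_iota tau_gt0 ltnS leqnSn.
Qed.

Lemma RN_den_le : (tau < T)%N -> RN_den N T Y tau.+1 <= 2 * sigma * U.
Proof.
move=> tT; rewrite /RN_den big_seq; apply: bigmax_le.
  (* The maximum starts from the default value 0, so the bound must also be nonnegative. *)
  by rewrite !mulr_ge0 ?(ltW sigma_gt0)// sumr_ge0.
move=> s; rewrite mem_index_iota => /andP[ts sT].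
rewrite sum_centered_exchange.
under eq_bigr do rewrite Yobs_sum (eq_bigr _ (fun r _ => Yobs_sum r)).
by apply: after_change_le => //; rewrite leqnSn.
Qed.

Lemma RN_den_ge0 (t : nat) : 0 <= RN_den N T Y t.
Proof. exact: bigmax_ge_id. Qed.

End statistics.

(** * Measurability of the statistics *)

Section measurability.
Context d (Omega : measurableType d) (R : realType).
Variables (N T : nat) (Y : nat -> nat -> Omega -> R).
Hypothesis mY : forall i t, (0 < i)%N -> (0 < t <= T)%N ->
  measurable_fun setT (Y i t).

Lemma measurable_sum_centered (a b a' b' : nat) (c : R) :
  (0 < a)%N -> (b <= T.+1)%N -> (0 < a')%N -> (b' <= T.+1)%N ->
  measurable_fun setT (fun w => `|\sum_(1 <= i < N.+1) \sum_(a <= s < b)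
    (Y i s w - c * \sum_(a' <= r < b') Y i r w)|).
Proof.
move=> a0 bT a'0 b'T; apply: measurableT_comp => //.
apply: measurable_sum_seq => i; rewrite mem_index_iota => /andP[i0 _].
apply: measurable_sum_seq => s; rewrite mem_index_iota => /andP[s0 sb].
apply: measurable_funB; first by apply: mY => //; lia.
apply: measurable_funM; first exact: measurable_cst.
apply: measurable_sum_seq => r; rewrite mem_index_iota => /andP[r0 rb].
by apply: mY => //; lia.
Qed.

Lemma measurable_CN : measurable_fun setT (fun w => CN N T (fun i t => Y i t w)).
Proof.
apply: measurable_funM; first exact: measurable_cst.
apply: measurable_bigmaxr_seq => t; rewrite mem_index_iota => /andP[t0 tT].
by apply: measurable_sum_centered => //; lia.
Qed.

Lemma measurable_RN_num (t : nat) : (t <= T)%N ->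
  measurable_fun setT (fun w => RN_num N (fun i t => Y i t w) t).
Proof.
move=> tT; apply: measurable_bigmaxr_seq => s.
rewrite mem_index_iota => /andP[s0 st].
by apply: measurable_sum_centered => //; lia.
Qed.

Lemma measurable_RN_den (t : nat) :
  measurable_fun setT (fun w => RN_den N T (fun i t => Y i t w) t).
Proof.
apply: measurable_bigmaxr_seq => s.
rewrite mem_index_iota => /andP[ts sT].
by apply: measurable_sum_centered => //; lia.
Qed.

Lemma measurable_RNstat_le (M : R) :
  measurable [set w | (RNstat N T (fun i t => Y i t w) <= M%:E)%E].
Proof.
apply: measurable_bigmax_eratio_le.
- move=> t; rewrite mem_index_iota => /andP[_ tT].
  by apply: measurable_RN_num; lia.
- by move=> t _; exact: measurable_RN_den.
- by move=> t w; exact: bigmax_ge_id.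
Qed.

End measurability.

(** * Divergence in probability *)

(** The probabilistic core shared by both statistics, with [A N] the event that the statistic stays
    below a fixed level. The sum [Q N] of squared total noises has mean [T * N], which is the scale
    required by [cvg_probability0]. *)
Lemma cvg_noise_dominated (d : measure_display) (Omega : measurableType d)
    (R : realType) (P : probability Omega R) (T : nat)
    (eps : nat -> nat -> Omega -> R) (D : nat -> R) (A : nat -> set Omega)
    (c M B : R) :
  (forall i t, (0 < i)%N -> (1 <= t <= T)%N -> eps i t \in Lfun P 2%:E) ->
  (forall i t, (0 < i)%N -> (1 <= t <= T)%N -> ('E_P[eps i t] = 0)%E) ->
  (forall i t, (0 < i)%N -> (1 <= t <= T)%N -> ('V_P[eps i t] = 1)%E) ->
  rows_independent P T eps ->
  ((fun N : nat => (Num.sqrt N%:R)^-1 * `|D N|) @ \oo --> +oo) ->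
  0 < c -> 0 < B ->
  (forall N, measurable (A N)) ->
  (forall N w, (0 < N)%N -> A N w ->
    c * `|D N| <= M * Num.sqrt N%:R +
      B * \sum_(1 <= t < T.+1) `|\sum_(1 <= i < N.+1) eps i t w|) ->
  (fun N => P (A N)) @ \oo --> 0%E.
Proof.
move=> eps2 E0 V1 indep Doo c0 B0 mA AD.
have Pfin : P setT \is a fin_num := fin_num_measure P _ measurableT.
have mE i t : (0 < i)%N -> (1 <= t <= T)%N -> measurable_fun setT (eps i t).
  move=> i0 tT; have /Lfun1_integrable h := Lfun_subset12 Pfin (eps2 i t i0 tT).
  exact/measurable_EFinP/(measurable_int _ h).
pose S N t w := \sum_(1 <= i < N.+1) eps i t w.
pose Q N w := \sum_(1 <= t < T.+1) S N t w ^+ 2.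
have S2 N t : (1 <= t <= T)%N -> S N t \in Lfun P 2%:E.
  move=> tT; rewrite (_ : S N t = \sum_(1 <= i < N.+1) eps i t).
    have le12 : (1 <= 2%:E :> \bar R)%E by rewrite lee_fin ler1n.
    rewrite big_seq rpred_sum// => i; rewrite mem_index_iota => /andP[i0 _].
    exact: eps2.
  by apply/funext => w; rewrite fct_sumE.
have ES N t : (1 <= t <= T)%N -> ('E_P[fun w => (S N t w ^+ 2)%R] = N%:R%:E)%E.
  move=> tT.
  rewrite (@expectation_sqr_sum_orthonormal _ _ _ P _ _ (fun i => eps i t)).
  - by rewrite size_iota subn1.
  - exact: iota_uniq.
  - by move=> i; rewrite mem_index_iota => /andP[i0 _]; exact: eps2.
  - move=> i j; rewrite !mem_index_iota => /andP[i0 _] /andP[j0 _].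
    (* On the diagonal the second moment is the variance, the mean being 0; off the diagonal
       independence factors the expectation into a product of zero means. *)
    have [->|ij] := eqVneq i j.
      have := V1 _ _ j0 tT; rewrite varianceE ?eps2// E0//.
      by rewrite expe2 mule0 sube0 => <-; rewrite expr2.
    rewrite expectation_mul_independent ?eps2// ?E0 ?mule0//.
    by move=> X Z mX mZ; apply: (@rows_independent_pair _ _ _ P T eps i j t) => //; exact: mE.
have mS N t : (1 <= t <= T)%N -> measurable_fun setT (S N t).
  move=> tT; apply: measurable_sum_seq => i; rewrite mem_index_iota => /andP[i0 _].
  exact: mE.
have EQ N : ('E_P[Q N] = (T%:R * N%:R)%:E)%E.
  rewrite (@expectation_bigsum _ _ _ P _ _ (fun t w => S N t w ^+ 2)); last first.
    move=> t; rewrite mem_index_iota => tT.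
    by rewrite (_ : (fun w => _) = S N t \* S N t)// Lfun2_mul_Lfun1// S2.
  rewrite big_seq (eq_bigr (fun=> N%:R%:E)); last first.
    by move=> t; rewrite mem_index_iota => tT; exact: ES.
  by rewrite -big_seq sumEFin sumr_const_nat subn1 mulr_natl.
(* The constants come from dividing the hypothesis by [c] times the square root of [N]; the term
   [B * T] collects the 1 in [y <= 1 + y^2] over the [T] times. *)
apply: (@cvg_probability0 _ _ _ P A Q
  (fun N => (Num.sqrt N%:R)^-1 * `|D N|) (c^-1 * (M + B * T%:R)) (c^-1 * B) T%:R) => //.
- by rewrite mulr_gt0// invr_gt0.
- move=> N; apply: measurable_sum_seq => t; rewrite mem_index_iota => tT.
  by apply: measurable_funX; exact: mS.
- by move=> N w; apply: sumr_ge0 => t _; exact: sqr_ge0.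
- by move=> N; rewrite EQ.
- move=> N w N0 Aw.
  have q0 : 0 < Num.sqrt N%:R :> R by rewrite sqrtr_gt0 ltr0n.
  have q2 : Num.sqrt N%:R ^+ 2 = N%:R :> R by rewrite sqr_sqrtr.
  have := sum_norm_le_sqr R T (S N ^~ w) _ q0; rewrite q2 -/(Q N w).
  have := AD N w N0 Aw; rewrite -/(S N).
  set q := Num.sqrt _ in q0 *; set u := \sum_(1 <= t < _) _ => h1 h2.
  rewrite -mulrA -mulrDr ler_pdivlMl// mulrCA.
  apply: (@le_trans _ _ (q^-1 * (M * q + B * u))).
    by rewrite ler_pM2l// invr_gt0.
  rewrite mulrDr (mulrC M) mulKf ?gt_eqF// -addrA lerD2l -mulrDr mulrCA ler_pM2l//.
  by rewrite [Q N w / _]mulrC.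
Qed.

Theorem theorem2 (d : measure_display) (Omega : measurableType d) (R : realType)
  (P : probability Omega R)
  (T tau : nat) (sigma : R) (mu : nat -> R) (delta : nat -> nat -> R)
  (eps : nat -> nat -> Omega -> R) :
  (1 <= tau)%N -> (tau + 3 <= T)%N ->
  0 < sigma ->
  (* error assumption *)
  (forall i t, (0 < i)%N -> (1 <= t <= T)%N -> eps i t \in Lfun P 2%:E) ->
  (forall i t, (0 < i)%N -> (1 <= t <= T)%N -> ('E_P[eps i t] = 0)%E) ->
  (forall i t, (0 < i)%N -> (1 <= t <= T)%N -> ('V_P[eps i t] = 1)%E) ->
  (forall i k s s', (0 < i)%N -> (1 <= s)%N -> (s + k <= T)%N ->
      (1 <= s')%N -> (s' + k <= T)%N ->
      covariance P (eps i s) (eps i (s + k)) = covariance P (eps i s') (eps i (s' + k))) ->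
  rows_independent P T eps ->
  rows_identically_distributed P T eps ->
  (* change sizes *)
  ((fun N : nat => (Num.sqrt N%:R)^-1 * `| \sum_(1 <= i < N.+1) delta N i |)
     @ \oo --> +oo) ->
  (forall M : R,
     (fun N : nat => P [set w | CN N T (fun i t => Yobs mu delta sigma tau eps N i t w) <= M])
       @ \oo --> 0%E) /\
  (forall M : R,
     (fun N : nat => P [set w | (RNstat N T (fun i t => Yobs mu delta sigma tau eps N i t w)
                                 <= M%:E)%E])
       @ \oo --> 0%E).
Proof.
move=> tau0 tauT sigma0 eps2 E0 V1 _ indep _ Doo.
have tT : (tau < T)%N by lia.
have mY N i t : (0 < i)%N -> (1 <= t <= T)%N ->
    measurable_fun setT (Yobs mu delta sigma tau eps N i t).
  move=> i0 tT'; apply: measurable_funD; first exact: measurable_cst.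
  apply: measurable_funM; first exact: measurable_cst.
  have Pfin : P setT \is a fin_num := fin_num_measure P _ measurableT.
  have /Lfun1_integrable h := Lfun_subset12 Pfin (eps2 i t i0 tT').
  exact/measurable_EFinP/(measurable_int _ h).
split=> M.
- apply: (@cvg_noise_dominated _ _ _ _ _ _ _ _ (tau%:R * (T - tau)%:R / T%:R) M
    (2 * sigma) eps2 E0 V1 indep Doo).
  + by rewrite divr_gt0 ?mulr_gt0 ?ltr0n ?subn_gt0//; lia.
  + by rewrite mulr_gt0.
  + move=> N; rewrite -[X in measurable X]setTI.
    apply: (@measurable_fun_le _ _ _ setT _ (cst M)) => //.
    by apply: (@measurable_CN _ _ _ _ _ (Yobs mu delta sigma tau eps N)); exact: mY.
  + move=> N w N0 /=.
    have q0 : 0 < Num.sqrt N%:R :> R by rewrite sqrtr_gt0 ltr0n.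
    have := @CN_ge R Omega T tau sigma mu delta eps N w tau0 sigma0 tT.
    move=> /le_trans /[apply].
    by rewrite ler_pdivrMl// lerBlDr [M * _]mulrC.
(* The ratio carries no normalisation in [N], hence the constant 0. The factor [1 + |M|] adds the
   noise lost in the numerator to [|M|] times the bound on the denominator. *)
- apply: (@cvg_noise_dominated _ _ _ _ _ _ _ _ (tau%:R / tau.+1%:R) 0
    (2 * sigma * (1 + `|M|)) eps2 E0 V1 indep Doo).
  + by rewrite divr_gt0 ?ltr0n.
  + by rewrite !mulr_gt0// ltr_wpDr.
  + move=> N; apply: (@measurable_RNstat_le _ _ _ _ _ (Yobs mu delta sigma tau eps N)).
    exact: mY.
  + move=> N w N0 /=; set Y := fun i t => _; rewrite /RNstat => RM.
    (* The split [tau + 1] is admissible: it is at least 2 since [tau >= 1], and at most [T - 2]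
       since [tau + 3 <= T]. *)
    have : (eratio (RN_num N Y tau.+1) (RN_den N T Y tau.+1) <= M%:E)%E.
      apply: le_trans RM; apply: (@bigmax_sup_seq _ _ _ _ _ tau.+1) => //.
      by rewrite mem_index_iota; lia.
    have den0 := RN_den_ge0 R Omega T tau sigma mu delta eps N w tau.+1.
    have den1 := RN_den_le R Omega T tau sigma mu delta eps N w tau0 sigma0 tT.
    have num1 := RN_num_ge R Omega T tau sigma mu delta eps N w tau0 sigma0 tT.
    rewrite -/Y in den0 den1 num1; rewrite eratio_le//.
    set a := RN_num _ _ _ in num1 *; set b := RN_den _ _ _ _ in den0 den1 *.
    (* Passing to [|M|] allows the upper bound on [b] to be substituted whatever the sign of [M]; if
       [b] vanishes, so does [a]. *)
    move=> ab; have {ab} aMb : a <= `|M| * b.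
      move: ab; have [b0 /andP[/eqP -> _]|_ /le_trans] := eqVneq b 0.
        by rewrite mulr_ge0.
      by apply; rewrite ler_wpM2r// ler_norm.
    have aMu := le_trans aMb (ler_wpM2l (normr_ge0 M) den1).
    rewrite mul0r add0r [leRHS]mulrAC mulrDr mulr1 [X in _ + X]mulrC -lerBlDl.
    exact: le_trans num1 aMu.
Qed.
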